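(* Let $n\ge2$ be an integer, and let $\mathcal{G}_1$ and $\mathcal{G}_2$ be two adjacent $n$-grids with representations $\mathcal{G}(\delta_1,\mathcal{L}_{\mathbf{a}})$ and $\mathcal{G}(\delta_2,\mathcal{L}_{\mathbf{b}})$, respectively. Let $$C_1:=\liminf_{j\to+\infty}\left|\frac{\mathcal{L}_{\mathbf{a}}(j)-\mathcal{L}_{\mathbf{b}}(j)}{n^j}\right|>0\quad\text{and}\quad C_2:=\limsup_{j\to+\infty}\left|\frac{\mathcal{L}_{\mathbf{a}}(j)-\mathcal{L}_{\mathbf{b}}(j)}{n^j}\right|<1.$$ Let $\mathcal{G}(\delta_1',\mathcal{L}_{\mathbf{a}'})$ and $\mathcal{G}(\delta_2',\mathcal{L}_{\mathbf{b}'})$ be some other representations of $\mathcal{G}_1$ and $\mathcal{G}_2$, respectively. Then either $$\liminf_{j\to+\infty}\left|\frac{\mathcal{L}_{\mathbf{a}'}(j)-\mathcal{L}_{\mathbf{b}'}(j)}{n^j}\right|=C_1\quad\text{and}\quad\limsup_{j\to+\infty}\left|\frac{\mathcal{L}_{\mathbf{a}'}(j)-\mathcal{L}_{\mathbf{b}'}(j)}{n^j}\right|=C_2,$$ or $$\liminf_{j\to+\infty}\left|\frac{\mathcal{L}_{\mathbf{a}'}(j)-\mathcal{L}_{\mathbf{b}'}(j)}{n^j}\right|=1-C_2\quad\text{and}\quad\limsup_{j\to+\infty}\left|\frac{\mathcal{L}_{\mathbf{a}'}(j)-\mathcal{L}_{\mathbf{b}'}(j)}{n^j}\right|=1-C_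1.$$
   Context: Fix an integer $n\ge 2$; $\mathbb{N}=\{0,1,2,\dots\}$. General dyadic grid with base $n$ ($n$-grid): a collection $\mathcal{G}$ of left-closed, right-open intervals on $\mathbb{R}$ such that (i) every $Q\in\mathcal{G}$ has length $n^k$ for some $k\in\mathbb{Z}$; (ii) $Q\cap R\in\{Q,R,\emptyset\}$ for all $Q,R\in\mathcal{G}$; (iii) for each fixed $k\in\mathbb{Z}$ the intervals of $\mathcal{G}$ of length $n^k$ form a partition of $\mathbb{R}$. Location function: for a sequence $\mathbf{a}=\{a_0,a_1,\dots\}$ with $a_i\in\{0,1,\dots,n-1\}$, $\mathcal{L}_{\mathbf{a}}:\mathbb{N}\to\mathbb{N}$ is given by $\mathcal{L}_{\mathbf{a}}(0)=0$ and $\mathcal{L}_{\mathbf{a}}(j)=\sum_{i=0}^{j-1}a_i n^i$ for $j\ge 1$. The grid $\mathcal{G}(\delta,\mathcal{L}_{\mathbf{a}})$, for $\delta\in\mathbb{R}$, is the union over $m\in\mathbb{Z}$ of its $m$-th generations $\mathcal{G}(\delta,\mathcal{L}_{\mathbf{a}})_m$, where for $m\ge 0$ $$\mathcal{G}(\delta,\mathcal{L}_{\mathbf{a}})_m=\left\{\left[\delta+\tfrac{k}{n^m},\ \delta+\tfrac{k+1}{n^m}\right):k\in\mathbb{Z}\right\},$$ and for $m<0$ $$\mathcal{G}(\delta,\mathcal{L}_{\mathbf{a}})_m=\left\{\left[\delta+\mathcal{L}_{\mathbf{a}}(-m)+\tfrac{k}{n^m},\ \delta+\mathcal{L}_{\mathbf{a}}(-m)+\tfrac{k+1}{n^m}\right):k\in\mathbb{Z}\right\}.$$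 This is an $n$-grid. Representation: $\mathcal{G}(\delta,\mathcal{L}_{\mathbf{a}})$ (with $\delta\in\mathbb{R}$ and $\mathbf{a}$ a sequence in $\{0,\dots,n-1\}$) is a representation of an $n$-grid $\mathcal{G}$ if $\mathcal{G}=\mathcal{G}(\delta,\mathcal{L}_{\mathbf{a}})$. Representations need not be unique. Adjacency: two $n$-grids $\mathcal{G}_1,\mathcal{G}_2$ are adjacent if there is a constant $C>0$, independent of $Q$, such that for each bounded interval $Q\subset\mathbb{R}$ of positive length there is an interval $I$ with $Q\subset I$, $|I|\le C|Q|$, and $I\in\mathcal{G}_1$ or $I\in\mathcal{G}_2$ (here $|\cdot|$ is length). *)

(* Defs.v *)
From mathcomp Require Import all_boot all_order all_algebra.
From mathcomp Require Import all_classical all_reals all_analysis.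

Set Implicit Arguments.
Unset Strict Implicit.
Unset Printing Implicit Defensive.

Import Order.TTheory GRing.Theory Num.Theory.
Import numFieldNormedType.Exports.

Local Open Scope classical_set_scope.
Local Open Scope ring_scope.

(* The length of a nonempty bounded interval; it is only applied to bounded
   sets, and its value on set0 is 0 since sup and inf both default to 0. *)
Definition itv_length (R : realType) (Q : set R) : R := sup Q - inf Q.

Lemma itv_length_co (R : realType) (x y : R) :
  x < y -> itv_length `[x, y[%classic = y - x.
Proof. by move=> xy; rewrite /itv_length sup_itv ?inf_itv ?bnd_simp. Qed.

Definition left_closed_right_open (R : realType) (Q : set R) : Prop :=
  exists x y : R, Q = `[x, y[%classic.

Definition is_ngrid (R : realType) (n : nat) (G : set (set R)) : Prop :=
  [/\ forall Q, G Q -> left_closed_right_open Q,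
      forall Q, G Q -> exists k : int, itv_length Q = n%:R ^ k,
      forall Q S, G Q -> G S -> [\/ Q `&` S = Q, Q `&` S = S | Q `&` S = set0]
    & forall k : int,
        partition [set Q | G Q /\ itv_length Q = n%:R ^ k] id setT].

Definition location (n : nat) (a : nat -> 'I_n) (j : nat) : nat :=
  (\sum_(i < j) a i * n ^ i)%N.

(* Negz p denotes - (p.+1), so that the location function is taken at - m. *)
Definition grid_shift (n : nat) (a : nat -> 'I_n) (m : int) : nat :=
  match m with
  | Posz _ => 0
  | Negz p => location a p.+1
  end.

Definition grid_gen (R : realType) (n : nat) (delta : R) (a : nat -> 'I_n)
    (m : int) : set (set R) :=
  [set Q | exists k : int,
     Q = `[delta + (grid_shift a m)%:R + k%:~R / n%:R ^ m,
           delta + (grid_shift a m)%:R + (k + 1)%:~R / n%:R ^ m[%classic].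

Definition grid (R : realType) (n : nat) (delta : R) (a : nat -> 'I_n) :
    set (set R) :=
  \bigcup_(m in [set: int]) grid_gen delta a m.

Definition is_representation (R : realType) (n : nat) (G : set (set R))
    (delta : R) (a : nat -> 'I_n) : Prop :=
  G = grid delta a.

Definition adjacent_grids (R : realType) (G1 G2 : set (set R)) : Prop :=
  exists C : R, 0 < C /\
    forall Q : set R, is_interval Q -> bounded_set Q -> 0 < itv_length Q ->
      exists I : set R, [/\ Q `<=` I, itv_length I <= C * itv_length Q
                          & G1 I \/ G2 I].

Definition location_gap (R : realType) (n : nat) (a b : nat -> 'I_n) : R^nat :=
  fun j => `| ((location a j)%:R - (location b j)%:R) / n%:R ^+ j |.
Arguments location_gap R {n} a b _.

(* Main.v *)
Require Import Defs.
From mathcomp Require Import all_boot all_order all_algebra.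
From mathcomp Require Import all_classical all_reals all_analysis.
From mathcomp Require Import lra zify.

Set Implicit Arguments.
Unset Strict Implicit.
Unset Printing Implicit Defensive.

Import Order.TTheory GRing.Theory Num.Theory.
Import numFieldNormedType.Exports.

Local Open Scope classical_set_scope.
Local Open Scope ring_scope.

(** Write x_j for the signed quotient (L_a(j) - L_b(j)) / n^j, so that the gap is
    |x_j| < 1, and x'_j for the quotient of the other representations.

    Comparing the intervals of length n^j of one grid in its two representations
    gives L_a(j) - L_a'(j) = D + e_j n^j, where D is the difference of the two
    origins and e_j is an integer ([grid_eq_offset]).  Passing from j to j + 1
    appends the digits a_j and a'_j, whence n e_{j+1} = e_j + (a_j - a'_j): the
    integer e_j is the carry of an n-adic addition.  As |a_j - a'_j| < n, the
    carry keeps its sign and does not grow in absolute value, hence it is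
    eventually constant ([carry_stationary], [grid_eq_location]).

    Apply this to both grids and subtract: for some fixed integer s, eventually
    x'_j = x_j - s - eps_j, with eps_j a constant over n^j and so tending to 0.
    If s = 0, the two gaps differ by a null sequence and have the same lower and
    upper limits.  If s <> 0, the bounds 0 < C1 and C2 < 1 keep |x_j| away from 0
    and 1, and |x'_j| < 1 then leaves only s = 1 with x_j > 0, or s = -1 with
    x_j < 0; in both cases |x'_j| is 1 - |x_j| up to |eps_j|
    ([shifted_norm_add]), and t -> 1 - t exchanges the lower and upper limits and
    sends C1, C2 to 1 - C1, 1 - C2. *)

(** * Lower and upper limits of bounded real sequences *)

Lemma is_cvg_sups_bounded (R : realType) (u : R^nat) :
  bounded_fun u -> cvgn (sups u).
Proof.
move=> bu; apply: nonincreasing_is_cvgn; last exact: bounded_fun_has_lbound_sups.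
exact/nonincreasing_sups/bounded_fun_has_ubound.
Qed.

Lemma is_cvg_infs_bounded (R : realType) (u : R^nat) :
  bounded_fun u -> cvgn (infs u).
Proof.
move=> bu; apply: nondecreasing_is_cvgn; last exact: bounded_fun_has_ubound_infs.
exact/nondecreasing_infs/bounded_fun_has_lbound.
Qed.

Lemma limn_infN_bounded (R : realType) (u : R^nat) :
  bounded_fun u -> limn_inf (-%R \o u) = - limn_sup u.
Proof.
by move=> bu; rewrite /limn_inf infsN limN//; exact: is_cvg_sups_bounded.
Qed.

Lemma limn_supN_bounded (R : realType) (u : R^nat) :
  bounded_fun u -> limn_sup (-%R \o u) = - limn_inf u.
Proof.
by move=> bu; rewrite /limn_sup supsN limN//; exact: is_cvg_infs_bounded.
Qed.

(** Adding a sequence which converges to l merely translates the upper limit: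
    subadditivity gives one inequality, and the other one by adding - w back. *)
Lemma limn_supD_cvgr (R : realType) (u w : R^nat) (l : R) :
  bounded_fun u -> w @ \oo --> l -> limn_sup (u \+ w) = limn_sup u + l.
Proof.
move=> bu wl; have bw : bounded_fun w by apply: cvg_seq_bounded; apply/cvg_ex; exists l.
have bNw : bounded_fun (-%R \o w) by exact: bounded_funN.
have buw : bounded_fun (u \+ w) by exact: bounded_funD.
have supw := (cvg_limn_inf_sup wl).2.
have supNw : limn_sup (-%R \o w) = - l.
  by rewrite limn_supN_bounded// (cvg_limn_inf_sup wl).1.
apply/eqP; rewrite eq_le; apply/andP; split.
  by rewrite -supw; exact: le_limn_supD.
have := le_limn_supD buw bNw; rewrite supNw lerBrDr.
suff -> : (u \+ w) \+ (-%R \o w) = u by [].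
by apply/funext => j /=; rewrite addrK.
Qed.

Lemma limn_infD_cvgr (R : realType) (u w : R^nat) (l : R) :
  bounded_fun u -> w @ \oo --> l -> limn_inf (u \+ w) = limn_inf u + l.
Proof.
move=> bu wl; have bNu : bounded_fun (-%R \o u) by exact: bounded_funN.
have bw : bounded_fun w by apply: cvg_seq_bounded; apply/cvg_ex; exists l.
have Nwl : (-%R \o w) @ \oo --> - l by exact: cvgN.
apply: oppr_inj; rewrite -limn_supN_bounded; last exact: bounded_funD.
have -> : -%R \o (u \+ w) = (-%R \o u) \+ (-%R \o w).
  by apply/funext => j /=; rewrite opprD.
by rewrite (limn_supD_cvgr bNu Nwl) limn_supN_bounded// opprD.
Qed.

(** This and its dual turn the strict bounds on the lower and upper limits into
    termwise bounds, which confine a gap to a compact part of ]0, 1[. *)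
Lemma near_gt_limn_inf (R : realType) (u : R^nat) (c : R) :
  bounded_fun u -> c < limn_inf u -> \forall j \near \oo, c < u j.
Proof.
move=> bu cu.
have : \forall j \near \oo, c < infs u j.
  exact: (cvgr_gt _ (is_cvg_infs_bounded bu) _ cu).
apply: filterS => j /lt_le_trans; apply.
apply: ge_inf; last by exists j => /=.
exact/has_lbound_sdrop/bounded_fun_has_lbound.
Qed.

Lemma near_lt_limn_sup (R : realType) (u : R^nat) (c : R) :
  bounded_fun u -> limn_sup u < c -> \forall j \near \oo, u j < c.
Proof.
move=> bu uc.
have : \forall j \near \oo, sups u j < c.
  exact: (cvgr_lt _ (is_cvg_sups_bounded bu) _ uc).
apply: filterS => j; apply: le_lt_trans.
apply: ub_le_sup; last by exists j => /=.
exact/has_ubound_sdrop/bounded_fun_has_ubound.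
Qed.

(** * The carry of an n-adic addition *)

(** When e_i >= 0, the bound |c_i| < n gives n e_{i+1} > - n, so e_{i+1} >= 0, and
    n e_{i+1} <= e_i + n - 1, so e_{i+1} <= e_i: from the index j on, e is a
    nonincreasing sequence of natural numbers.  The induction is on a bound of
    e_j. *)
Lemma carry_stationary_nneg (n : nat) (c e : nat -> int) :
  (forall j, e j.+1 * n%:Z = e j + c j) -> (forall j, `|c j| < n%:Z) ->
  forall (k : nat) (j : nat), 0 <= e j <= k%:Z ->
  exists s, \forall i \near \oo, e i = s.
Proof.
move=> rec cn.
have dec i : 0 <= e i -> 0 <= e i.+1 <= e i.
  by move: (rec i) (cn i); nia.
elim=> [|k IH] j /andP[ej0 ejk].
  exists 0; exists j => // i /= ji.
  suff : 0 <= e i <= 0 by lia.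
  elim: i ji => [|i IHi]; first by rewrite leqn0 => /eqP <-; rewrite ej0.
  rewrite leq_eqVlt => /orP[/eqP <-|/IHi/andP[ei0 eil0]]; first by rewrite ej0.
  by move: (dec i ei0); lia.
have nonneg i : (j <= i)%N -> 0 <= e i.
  elim: i => [|i IHi]; first by rewrite leqn0 => /eqP <-.
  rewrite leq_eqVlt => /orP[/eqP <-//|/IHi/dec/andP[]//].
have [[i [ji eik]]|none] := pselect (exists i, (j <= i)%N /\ e i <= k%:Z).
  by apply: (IH i); rewrite nonneg.
exists k.+1%:Z; exists j => // i /= ji.
have ub : e i <= k.+1%:Z.
  elim: i ji => [|i IHi]; first by rewrite leqn0 => /eqP <-.
  rewrite leq_eqVlt => /orP[/eqP <-//|ji].
  by apply: le_trans (IHi ji); have /andP[] := dec i (nonneg i ji).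
apply/eqP; rewrite eq_le ub leNgt; apply/negP => lt.
by apply: none; exists i; split => //; lia.
Qed.

(** The recurrence is invariant under (c, e) |-> (- c, - e), so the sign of e_0
    may be chosen. *)
Lemma carry_stationary (n : nat) (c e : nat -> int) :
  (forall j, e j.+1 * n%:Z = e j + c j) -> (forall j, `|c j| < n%:Z) ->
  exists s, \forall i \near \oo, e i = s.
Proof.
move=> rec cn; have [e0|e0] := leP 0 (e 0%N).
  by apply: (@carry_stationary_nneg n c e rec cn `|e 0%N|%N 0%N); lia.
have recN j : - e j.+1 * n%:Z = - e j + - c j by move: (rec j); lia.
have cnN j : `|- c j| < n%:Z by rewrite normrN.
have [|s es] := @carry_stationary_nneg n _ _ recN cnN `|e 0%N|%N 0%N; first by lia.
by exists (- s); apply: filterS es => i <-; rewrite opprK.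
Qed.

(** * Two representations of the same grid *)

Lemma location_lt (n : nat) (a : nat -> 'I_n) j : (location a j < n ^ j)%N.
Proof.
elim: j => [|j IH]; first by rewrite /location big_ord0.
rewrite /location big_ord_recr /= -/(location a j) expnS.
by have := ltn_ord (a j); nia.
Qed.

Lemma location_diff_lt1 (R : realType) (n : nat) (a b : nat -> 'I_n) j :
  `|((location a j)%:R - (location b j)%:R) / n%:R ^+ j : R| < 1.
Proof.
have la : (location a j)%:R < (n ^ j)%:R :> R by rewrite ltr_nat location_lt.
have lb : (location b j)%:R < (n ^ j)%:R :> R by rewrite ltr_nat location_lt.
have la0 : 0 <= (location a j)%:R :> R by [].
have lb0 : 0 <= (location b j)%:R :> R by [].
have N0 : 0 < (n ^ j)%:R :> R by exact: le_lt_trans la.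
by rewrite -natrX ltr_norml ltr_pdivlMr// ltr_pdivrMr//; lra.
Qed.

Lemma bounded_location_gap (R : realType) (n : nat) (a b : nat -> 'I_n) :
  bounded_fun (location_gap R a b).
Proof.
exists 1; split=> // y y1 j _; rewrite /location_gap /= normr_id.
by rewrite (le_trans (ltW (location_diff_lt1 _ _ _ _)))// ltW.
Qed.

(** The interval of length n^j starting at delta + L_a(j) belongs to the second
    grid; its length determines its generation there, and its left endpoint is
    then some delta' + L_a'(j) + k n^j. *)
Lemma grid_eq_offset (R : realType) (n : nat) (delta delta' : R)
    (a a' : nat -> 'I_n) (j : nat) : (2 <= n)%N ->
  grid delta a = grid delta' a' ->
  exists k : int, delta + (location a j)%:R =
    delta' + (location a' j)%:R + k%:~R * n%:R ^+ j.
Proof.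
move=> n2 eqG.
have shiftE (c : nat -> 'I_n) : grid_shift c (- j%:Z) = location c j.
  by case: (j) => [|i] //=; rewrite /location big_ord0.
have n1 : 1 < n%:R :> R by rewrite ltr1n.
have n0 : 0 < n%:R :> R by exact: lt_trans n1.
have nX0 (m : int) : 0 < (n%:R ^ m)^-1 :> R by rewrite invr_gt0 exprz_gt0.
have : grid delta a `[delta + (location a j)%:R,
    delta + (location a j)%:R + n%:R ^+ j[%classic.
  exists (- j%:Z) => //; exists 0.
  by rewrite shiftE add0r mul0r addr0 mul1r -exprnN invrK.
rewrite eqG => -[m _ [k Ek]].
have lt1 : delta + (location a j)%:R < delta + (location a j)%:R + n%:R ^+ j :> R.
  by rewrite ltrDl exprn_gt0.
have lt2 : delta' + (grid_shift a' m)%:R + k%:~R / n%:R ^ m <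
    delta' + (grid_shift a' m)%:R + (k + 1)%:~R / n%:R ^ m :> R.
  by rewrite ltrD2l ltr_pM2r// ltr_int ltrDl.
have Xm : n%:R ^+ j = (n%:R ^ m)^-1 :> R.
  by have := congr1 (@itv_length R) Ek; rewrite !itv_length_co// intrD; lra.
have mE : m = - j%:Z.
  apply: (@ieexprIz R n%:R n0); first by rewrite gt_eqF.
  by rewrite -exprnN Xm invrK.
exists k; have := congr1 inf Ek; rewrite !inf_itv ?bnd_simp// => ->.
by rewrite mE shiftE -exprnN invrK.
Qed.

Lemma grid_eq_location (R : realType) (n : nat) (delta delta' : R)
    (a a' : nat -> 'I_n) : (2 <= n)%N ->
  grid delta a = grid delta' a' ->
  exists s : int, \forall j \near \oo,
    (location a j)%:R - (location a' j)%:R =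
    delta' - delta + s%:~R * n%:R ^+ j :> R.
Proof.
move=> n2 eqG.
have /choice[e eE] j := @grid_eq_offset R n delta delta' a a' j n2 eqG.
have n0 : 0 < n%:R :> R by rewrite ltr0n (leq_trans _ n2).
(* The difference of the relations at j + 1 and j, divided by n^j, is the carry
   recurrence. *)
have [||s es] := @carry_stationary n (fun j => (a j)%:Z - (a' j)%:Z) e.
- move=> j; apply/eqP; rewrite -(eqr_int R) intrM intrD intrB.
  apply/eqP/(mulIf (lt0r_neq0 (exprn_gt0 j n0))).
  have := eE j.+1; have := eE j.
  rewrite /location !big_ord_recr /= -!/(location _ _) !natrD !natrM !natrX exprS.
  by rewrite -!pmulrn; lra.
- by move=> j; have := ltn_ord (a j); have := ltn_ord (a' j); lia.
exists s; apply: filterS es => j <-.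
by have := eE j; lra.
Qed.

(** * Comparison of the gaps *)

(** For s > 0, the lower bound x > s - 1 + e > - c and c < |x| force x > 0, while
    s < x - e + 1 < 2 forces s = 1; then |x - 1 - e| = 1 - x + e.  The case s < 0
    follows by changing the signs of x, e and s. *)
Lemma shifted_norm_add (R : realType) (c x e : R) (s : int) :
  s != 0 -> c < `|x| -> `|x| < 1 - c -> `|x - s%:~R - e| < 1 -> `|e| < c ->
  `| `|x - s%:~R - e| + `|x| - 1 | <= `|e|.
Proof.
wlog sp : x e s / 0 < s => [wl s0 cx xc x'1 ec|].
  have [sp|sn] := ltP 0 s; first exact: wl.
  have eqN : - x - (- s)%:~R - - e = - (x - s%:~R - e).
    by rewrite mulrNz; lra.
  have := wl (- x) (- e) (- s); rewrite eqN !normrN.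
  by apply=> //; lia.
move=> _ cx; rewrite ltr_norml => /andP[Ncx xc].
rewrite ltr_norml => /andP[x'gt x'lt]; rewrite ltr_norml => /andP[Nce ec].
have s1 : s = 1.
  suff : s%:~R < 2%:~R :> R by rewrite ltr_int; lia.
  by lra.
rewrite s1 mulr1z in x'gt x'lt *.
have x0 : 0 < x.
  by rewrite ltNge; apply/negP => x0; move: cx; rewrite ler0_norm//; lra.
rewrite (gtr0_norm x0) (@ltr0_norm _ (x - 1 - e)); last by lra.
by rewrite le_eqVlt; apply/orP; left; apply/eqP; congr `|_|; lra.
Qed.

Theorem theorem3p14 (R : realType) (n : nat) (hn : (2 <= n)%N)
    (G1 G2 : set (set R))
    (hG1 : is_ngrid n G1) (hG2 : is_ngrid n G2) (hadj : adjacent_grids G1 G2)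
    (delta1 delta2 : R) (a b : nat -> 'I_n)
    (hrep1 : is_representation G1 delta1 a)
    (hrep2 : is_representation G2 delta2 b)
    (C1 C2 : R)
    (hC1 : C1 = limn_inf (location_gap R a b)) (hC1_gt0 : 0 < C1)
    (hC2 : C2 = limn_sup (location_gap R a b)) (hC2_lt1 : C2 < 1)
    (delta1' delta2' : R) (a' b' : nat -> 'I_n)
    (hrep1' : is_representation G1 delta1' a')
    (hrep2' : is_representation G2 delta2' b') :
  (limn_inf (location_gap R a' b') = C1 /\
   limn_sup (location_gap R a' b') = C2) \/
  (limn_inf (location_gap R a' b') = 1 - C2 /\
   limn_sup (location_gap R a' b') = 1 - C1).
Proof.
have [s1 H1] := grid_eq_location hn (etrans (esym hrep1) hrep1').
have [s2 H2] := grid_eq_location hn (etrans (esym hrep2) hrep2').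
set u := location_gap R a b in hC1 hC2; set u' := location_gap R a' b'.
pose x (c d : nat -> 'I_n) j : R :=
  ((location c j)%:R - (location d j)%:R) / n%:R ^+ j.
pose eps j : R := ((delta1' - delta1) - (delta2' - delta2)) / n%:R ^+ j.
have n1 : 1 < n%:R :> R by rewrite ltr1n.
have n0 : 0 < n%:R :> R by exact: lt_trans n1.
have epsto0 : eps @ \oo --> 0.
  rewrite -[0](mulr0 ((delta1' - delta1) - (delta2' - delta2))).
  apply: cvgM; first exact: cvg_cst.
  under eq_cvg do rewrite -exprVn.
  by apply: cvg_expr; rewrite ger0_norm ?invr_ge0 ?ltW// invf_lt1.
have nepsto0 : (fun j => `|eps j|) @ \oo --> 0.
  by rewrite -[0](@normr0 _ R); exact: cvg_norm.
have xE : \forall j \near \oo, x a' b' j = x a b j - (s1 - s2)%:~R - eps j.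
  apply: filterS2 H1 H2 => j e1 e2.
  have nX : n%:R ^+ j != 0 :> R by rewrite expf_neq0// lt0r_neq0.
  apply: (mulIf nX); rewrite /x /eps intrB !mulrBl !divfK//.
  by lra.
have bu : bounded_fun u := bounded_location_gap R a b.
have [s0|s0] := eqVneq (s1 - s2) 0; [left|right].
  have w0 : (fun j => u' j - u j) @ \oo --> 0.
    apply: norm_cvg0; apply: (squeeze_cvgr _ (cvg_cst 0) nepsto0).
    apply: filterS xE => j; rewrite s0 subr0 => xj.
    rewrite normr_ge0 /= /u' /u /location_gap -/(x a' b' j) -/(x a b j) xj.
    rewrite (le_trans (ler_dist_dist _ _))//.
    by rewrite addrAC subrr add0r normrN.
  have -> : u' = u \+ (fun j => u' j - u j).
    by apply/funext => j /=; rewrite addrC subrK.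
  by rewrite (limn_infD_cvgr bu w0) (limn_supD_cvgr bu w0) !addr0 hC1 hC2.
have w1 : (fun j => u' j + u j) @ \oo --> (1 : R).
  apply/subr_cvg0.
  apply: norm_cvg0; apply: (squeeze_cvgr _ (cvg_cst 0) nepsto0).
  (* Half of the distance from the limits C1 and C2 to the end points 0 and 1. *)
  have [c c0 [cC1 cC2]] : exists2 c : R, 0 < c & c < C1 /\ C2 < 1 - c.
    exists (Num.min C1 (1 - C2) / 2).
      by rewrite divr_gt0// lt_min hC1_gt0 subr_gt0.
    by case: (leP C1 (1 - C2)) => ?; split; lra.
  rewrite hC1 in cC1; rewrite hC2 in cC2.
  have small : \forall j \near \oo, `|eps j| < c := cvgr_lt _ nepsto0 _ c0.
  near=> j.
  have xj : x a' b' j = x a b j - (s1 - s2)%:~R - eps j by near: j.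
  have ltc : c < `|x a b j| by near: j; exact: near_gt_limn_inf.
  have gtc : `|x a b j| < 1 - c by near: j; exact: near_lt_limn_sup.
  have epsj : `|eps j| < c by near: j; exact: small.
  have := location_diff_lt1 R a' b' j; rewrite -/(x a' b' j) => x'1.
  rewrite normr_ge0 /= /u' /u /location_gap -/(x a' b' j) -/(x a b j).
  move: x'1; rewrite xj => x'1.
  by apply: (@shifted_norm_add R c).
(* Written in this way, u' is a sequence with lower limit - C2 and upper limit
   - C1, plus a sequence which converges to 1. *)
have -> : u' = (-%R \o u) \+ (fun j => u' j + u j).
  by apply/funext => j /=; rewrite addrCA addNr addr0.
have bNu : bounded_fun (-%R \o u) by exact: bounded_funN.
rewrite (limn_infD_cvgr bNu w1) (limn_supD_cvgr bNu w1).
rewrite limn_infN_bounded// limn_supN_bounded// -hC1 -hC2.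
by split; rewrite addrC.
Unshelve. all: by end_near.
Qed.
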